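(* Let $k\ge 2$ be an integer and $t>k-1$ a real number, both fixed. For each $n\ge 1$ let $\lambda_{k,n}(t)$ be a minimizer of $\lambda\mapsto\exp(-\lambda t)G_{k,n}(\lambda)$ over $\lambda\in[0,1]$, and let $\lambda_{k,\infty}(t)=1-\frac{k-1}{t}$. Then, as $n\to\infty$, $$\lambda_{k,n}(t)=\lambda_{k,\infty}(t)+\frac{k}{k-1}\,\frac{t-k+1}{n}+o(n^{-1}).$$
   Context: $\Delta^{k-1}=\{p\in\mathbb{R}^k: p_i\ge 0,\ \sum_{i=1}^k p_i=1\}$. For integers $k,n\ge1$, $p\in\Delta^{k-1}$ and $\lambda\in[0,1]$, $$G_{k,n}(\lambda,p):=\sum_{X_1,\dots,X_k}\binom{n}{X_1,\dots,X_k}\prod_{i=1}^k\left[\lambda X_i/n+(1-\lambda)p_i\right]^{X_i},$$ where the sum is over non-negative integers with $X_1+\dots+X_k=n$, and $0^0=1$. This value does not depend on $p\in\Delta^{k-1}$; the common value is denoted $G_{k,n}(\lambda)$, and it is a polynomial in $\lambda$. *)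

(* Defs.v *)
From HB Require Import structures.
From mathcomp Require Import all_boot all_order all_algebra.
From mathcomp Require Import all_classical all_reals all_analysis.
From mathcomp Require Import ring.
Set Implicit Arguments.
Unset Strict Implicit.
Unset Printing Implicit Defensive.
Import Order.TTheory GRing.Theory Num.Theory.
Import numFieldNormedType.Exports.
Local Open Scope classical_set_scope.
Local Open Scope ring_scope.

Definition simplex (R : realType) (k : nat) : set 'rV[R]_k :=
  [set p | (forall i, 0 <= p ord0 i) /\ \sum_(i < k) p ord0 i = 1].
Arguments simplex : clear implicits.

(* Tuples (X_1, .., X_k) of naturals with sum n have entries at most n, so they
   are the finite functions into 'I_n.+1 with that sum. *)
Definition Gp (R : realType) (k n : nat) (lam : R) (p : 'rV[R]_k) : R :=
  \sum_(X : {ffun 'I_k -> 'I_n.+1} | (\sum_(i < k) X i)%N == n)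
     (n`!%:R / \prod_(i < k) (X i)`!%:R) *
     \prod_(i < k) (lam * ((X i)%:R / n%:R) + (1 - lam) * p ord0 i) ^+ X i.

(* The common value of Gp over the simplex. It exists (lemma G_simplex), and it
   is unique as soon as 0 < k, so the default value 0 of xget is then unused. *)
Definition G (R : realType) (k n : nat) (lam : R) : R :=
  xget 0 [set g : R | forall p : 'rV[R]_k, simplex R k p -> Gp n lam p = g].
Arguments G {R} k n lam.

Definition is_minimizer (R : realType) (D : set R) (f : R -> R) (x : R) : Prop :=
  D x /\ forall y, D y -> f x <= f y.

(* The rest of the file shows that Gp does not depend on the point of the
   simplex: by Abel's identity, the convolution of the sequences
   (u + j y)^j / j! and (v + j y)^j / j! depends on u + v only. *)
Definition abel (R : realType) (y : R) (j : nat) (u : R) : R :=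
  (u + j%:R * y) ^+ j / j`!%:R.

Definition abel_conv (R : realType) (y : R) (m : nat) (u v : R) : R :=
  \sum_(j < m.+1) abel y j u * abel y (m - j) v.

Lemma is_derive_abel (R : realType) (y : R) j (f : R -> R) (x df : R) :
  is_derive x (1 : R) f df ->
  is_derive x (1 : R) (fun x => abel y j.+1 (f x)) (df * abel y j (f x + y)).
Proof.
move=> fdf; rewrite /abel.
have -> : (fun x => (f x + j.+1%:R * y) ^+ j.+1 / (j.+1)`!%:R) =
  (fun z => (j.+1)`!%:R^-1 *: ((f \+ cst (j.+1%:R * y)) ^+ j.+1) z) :> (R -> R).
  by apply/funext => z /=; rewrite !fctE /GRing.scale /= mulrC.
apply: is_derive_eq.
rewrite !fctE /= addr0 /GRing.scale /= factS natrM.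
have j0 : j`!%:R != 0 :> R by rewrite pnatr_eq0 -lt0n fact_gt0.
have j1 : 1 + j%:R != 0 :> R by rewrite nat1r pnatr_eq0.
have -> : f x + y + j%:R * y = f x + j.+1%:R * y by rewrite -natr1; ring.
rewrite -nat1r; set e := _ ^+ j; field.
by rewrite j0.
Qed.

Lemma abel_conv_eq (R : realType) (y : R) m u s :
  abel_conv y m u (s - u) = abel_conv y m 0 s.
Proof.
rewrite -[X in _ = abel_conv y m 0 X]subr0.
elim: m u s => [|m IH] u s.
  by rewrite /abel_conv !big_ord1 /abel /= !expr0.
apply: (@is_derive_0_is_cst R (fun u => abel_conv y m.+1 u (s - u))) => x.
have E : (fun u => abel_conv y m.+1 u (s - u)) =
    \sum_(j < m.+2) (fun u => abel y j u * abel y (m.+1 - j) (s - u)).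
  by apply/funext => z; rewrite fct_sumE.
have did : is_derive x (1 : R) (fun z : R => z) 1 by exact: is_derive_id.
have dsub : is_derive x (1 : R) (fun z : R => s - z) (-1).
  rewrite -[X in is_derive _ _ _ X]sub0r.
  exact: (is_deriveB (is_derive_cst s x (1 : R)) did).
pose dl (j : nat) := if j is j'.+1 then abel y j' (x + y) else 0.
have dlP j : is_derive x (1 : R) (fun z => abel y j z) (dl j).
  case: j => [|j] /=; last first.
    by have := is_derive_abel y j did; rewrite mul1r.
  have -> : (fun z => abel y 0 z) = cst 1 :> (R -> R).
    by apply/funext => z; rewrite /abel expr0 divr1.
  exact: is_derive_cst.
pose dr (j : nat) := if j is j'.+1 then - abel y j' (s - x + y) else 0.
have drP j : is_derive x (1 : R) (fun z => abel y j (s - z)) (dr j).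
  case: j => [|j] /=; last first.
    by have := is_derive_abel y j dsub; rewrite mulN1r.
  have -> : (fun z => abel y 0 (s - z)) = cst 1 :> (R -> R).
    by apply/funext => z; rewrite /abel expr0 divr1.
  exact: is_derive_cst.
rewrite E.
pose d (j : 'I_m.+2) := abel y j x * dr (m.+1 - j)%N
                        + abel y (m.+1 - j) (s - x) * dl j.
suff <- : \sum_(j < m.+2) d j = 0.
  by apply: is_derive_sum => j; exact: (is_deriveM (dlP j) (drP (m.+1 - j)%N)).
rewrite big_split /= [X in X + _]big_ord_recr /= subnn mulr0 addr0.
rewrite [X in _ + X]big_ord_recl /= mulr0 add0r.
have -> : \sum_(j < m.+1) abel y j x * dr (m.+1 - j)%N =
          - abel_conv y m x (s - x + y).
  rewrite /abel_conv -sumrN; apply: eq_bigr => j _.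
  by rewrite subSn ?leq_ord //= mulrN.
have -> : \sum_(j < m.+1) abel y (m.+1 - bump 0 j) (s - x) * abel y j (x + y) =
          abel_conv y m (x + y) (s - x).
  by rewrite /abel_conv; apply: eq_bigr => j _; rewrite /bump /= add1n subSS mulrC.
have -> : s - x + y = (s + y) - x by ring.
have -> : s - x = (s + y) - (x + y) by ring.
by rewrite !IH addrC subrr.
Qed.

Definition abel_poly (R : realType) (y : R) (n : nat) (u : R) : {poly R} :=
  \poly_(j < n.+1) abel y j u.

Lemma coef_abel_poly_prod (R : realType) (y : R) n k (x : 'I_k -> R) u m :
  (m <= n)%N ->
  (abel_poly y n u * \prod_(i < k) abel_poly y n (x i))`_m =
  (abel_poly y n 0 ^+ k * abel_poly y n (u + \sum_(i < k) x i))`_m.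
Proof.
elim: k x u m => [|k IH] x u m mn.
  by rewrite !big_ord0 expr0 mulr1 mul1r addr0.
have M v w j : (j <= n)%N -> (abel_poly y n v * abel_poly y n w)`_j =
    abel_conv y j v w.
  move=> jn; rewrite coefM; apply: eq_bigr => i _.
  rewrite !coef_poly !ltnS (leq_trans (leq_ord i) jn).
  by rewrite (leq_trans (leq_subr _ _) jn).
have C (p q r : {poly R}) : (forall j, (j <= n)%N -> p`_j = q`_j) ->
    (p * r)`_m = (q * r)`_m.
  move=> pq; rewrite !coefM; apply: eq_bigr => i _.
  by rewrite pq // (leq_trans (leq_ord i) mn).
rewrite !big_ord_recl mulrA.
rewrite (C _ (abel_poly y n 0 * abel_poly y n (u + x ord0))); last first.
  move=> j jn; rewrite !M // -(abel_conv_eq y j u).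
  by congr (abel_conv _ _ _ _); ring.
rewrite -mulrA exprS -mulrA addrA !(mulrC (abel_poly y n 0) (_ * _)); apply: C => j jn.
exact: IH.
Qed.

Lemma Gp_coef (R : realType) (k n : nat) (lam : R) (p : 'rV[R]_k) :
  Gp n lam p = n`!%:R *
    (\prod_(i < k) abel_poly (lam / n%:R) n ((1 - lam) * p ord0 i))`_n.
Proof.
under [in RHS]eq_bigr do rewrite /abel_poly poly_def.
rewrite bigA_distr_bigA /= coef_sum big_distrr /= /Gp big_mkcond /=.
apply: eq_bigr => X _.
rewrite scaler_prod prodrXr coefZ coefXn eq_sym.
case: eqP => _; last by rewrite !mulr0.
rewrite mulr1 -mulrA; congr (_ * _); rewrite /abel prodf_div mulrC.
by congr (_ / _); apply: eq_bigr => i _; congr (_ ^+ _); ring.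
Qed.

Lemma G_simplex (R : realType) (k n : nat) (lam : R) (p : 'rV[R]_k) :
  simplex R k p -> Gp n lam p = G k n lam.
Proof.
move=> ps.
have indep (q : 'rV[R]_k) : simplex R k q -> Gp n lam q = Gp n lam p.
  move=> qs; rewrite !Gp_coef; congr (_ * _).
  case: k p q ps qs => [|k] p q [_ p1] [_ q1]; first by rewrite !big_ord0.
  rewrite !big_ord_recl !coef_abel_poly_prod //.
  have S (r : 'rV[R]_k.+1) : \sum_(i < k.+1) r ord0 i = 1 ->
    (1 - lam) * r ord0 ord0 +
      \sum_(i < k) (1 - lam) * r ord0 (lift ord0 i) = 1 - lam.
    by move=> r1; rewrite -mulr_sumr -mulrDr -[RHS]mulr1 -r1 big_ord_recl.
  by rewrite !S.
rewrite /G; apply/esym/xget_unique; first by move=> q /indep.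
by move=> g /(_ p ps).
Qed.

(* Main.v *)
Require Import Defs.
From mathcomp Require Import all_boot all_order all_algebra.
From mathcomp Require Import all_classical all_reals all_analysis.
From mathcomp Require Import ring lra.
Import Order.TTheory GRing.Theory Num.Theory.
Import numFieldNormedType.Exports.
Local Open Scope classical_set_scope.
Local Open Scope ring_scope.

(** Write [a = k - 1] and let [P_n] be the polynomial in [l] with value
    [G_{k,n}(l)].

    Closed form. By Abel's identity, [G_{k,n}] is [n!] times a coefficient of
    the generating function [A_y(0)^a A_y(1 - l)], [y = l / n], where [A_y(u)] is
    the series with coefficients [(u + j y)^j / j!]. The relation
    [A_y(0) = 1 + y z A_y(y)] gives a Pascal-like recursion for these
    coefficients ([coef_abel_pow]), whence ([G_horner])
      [P_n(l) = sum_j binomial(a + j - 1, j) n(n-1)..(n-j+1) / n^j l^j].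
    It tends to [(1 - l)^(-a)] for [0 <= l < 1], which explains the limit
    [1 - a / t] of the minimizers.

    Differential equation. The ratio of consecutive coefficients of [P_n] is
    [(a + j) (1 - j / n) / (j + 1)], that is
      [(1 - l) P' = a P - ((a + 1) l P' + l^2 P'') / n],
    and there is a similar equation for each derivative of [P_n]
    ([horner_Gpoly_ode]). All derivatives being nonnegative for [0 <= l], the
    terms in [1 / n] may be dropped to bound the second and third derivatives
    by the first ([horner_derivn_Gpoly_le]).

    Expansion. An interior minimizer satisfies [P' = t P]. Put [q = P'' / P] at
    that point; the equation reads [l = 1 - a / t + X / n] where
    [X = (a + 1) l + l^2 q / t]. Once [q] is bounded, [l] tends to [1 - a / t];
    the differential equation for [P'] then forces [q] to tend to
    [(a + 1) t^2 / a], and [X] to [k (t - a) / a] ([cvg_critical]).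

    Interiority. Between 0 and [1 - a / t] the bound [(1 - l) P' <= a P] makes
    the objective decreasing, so minimizers are positive
    ([tilt_minimizer_gt0]). Comparison with the value 1 at 0 gives
    [P_n(l) <= e^t] at a minimizer, while [P_n] exceeds any constant near 1 for
    [n] large; hence minimizers stay away from 1 ([tilt_minimizer_away1]), which
    is what bounds [q]. *)

(** * The closed form of G *)

Lemma coefM_trunc {R : nzRingType} (p q r : {poly R}) m :
  (forall j, (j <= m)%N -> p`_j = q`_j) -> (p * r)`_m = (q * r)`_m.
Proof.
by move=> pq; rewrite !coefM; apply: eq_bigr => i _; rewrite pq // leq_ord.
Qed.

(** This is the relation [A_y(0) = 1 + y z A_y(y)] between the generating
    functions of Abel's polynomials, read on coefficients. *)
Lemma abelS0 {R : realType} (y : R) j : abel y j.+1 0 = y * abel y j y.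
Proof.
rewrite /abel factS natrM add0r.
have j0 : j`!%:R != 0 :> R by rewrite pnatr_eq0 -lt0n fact_gt0.
have j1 : 1 + j%:R != 0 :> R by rewrite nat1r pnatr_eq0.
have -> : y + j%:R * y = j.+1%:R * y by rewrite -natr1; ring.
rewrite exprS -nat1r; set e := _ ^+ j; field.
by rewrite j0.
Qed.

(** With [T] the tree function, [T = z e^(yT)], the product is the series
    [e^(uT) / (1 - yT)^(a+1)], and the right-hand side is its coefficient given
    by Lagrange inversion. The proof is a double induction: multiplying by
    [A_y(0) = 1 + y z A_y(y)] and merging [A_y(y) A_y(u)] into
    [A_y(0) A_y(u + y)] by Abel's identity yields the recursion
    [W(a+1, m+1, u) = W(a, m+1, u) + y W(a+1, m, u + y)], and Pascal's rule
    shows that the sum obeys it too. In ['C((a + j).-1, j)] the truncated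
    predecessor makes the case [a = 0] right: 1 at [j = 0], and 0 beyond. *)
Lemma coef_abel_pow {R : realType} (y : R) N a m u : (m <= N)%N ->
  (abel_poly y N 0 ^+ a * abel_poly y N u)`_m =
  \sum_(j < m.+1) 'C((a + j).-1, j)%:R * y ^+ j *
     ((u + m%:R * y) ^+ (m - j) / (m - j)`!%:R).
Proof.
elim: a m u => [m u mN|a IHa].
  rewrite expr0 mul1r coef_poly ltnS mN big_ord_recl big1 => [|j _].
    by rewrite /= bin0 expr0 !mul1r subn0 addr0.
  by rewrite bin_small ?mul0r //= lift0.
elim=> [|m IHm] u mN.
  rewrite big_ord1 /= bin0 !expr0 !mul1r exprS -mulrA.
  rewrite (@coefM_trunc _ _ 1) ?mul1r; last first.
    by case=> // _; rewrite coef_poly coef1 /= /abel expr0 divr1.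
  rewrite IHa // big_ord1 /= !expr0 bin0.
  by rewrite !mul1r.
rewrite exprS -mulrA.
(* A_y(0) = 1 + y z A_y(y) up to degree N *)
rewrite (@coefM_trunc _ _ (1 + y%:P * ('X * abel_poly y N y))); last first.
  move=> j jm; have jN := leq_trans jm mN.
  rewrite coefD coef1 coefCM coefXM coef_poly ltnS jN.
  case: j jm jN => [|j] jm jN /=; first by rewrite /abel expr0 divr1 mulr0 addr0.
  by rewrite coef_poly ltnS (ltnW jN) add0r abelS0.
rewrite mulrDl mul1r coefD IHa //.
have -> : (y%:P * ('X * abel_poly y N y) * (abel_poly y N 0 ^+ a * abel_poly y N u))`_m.+1
    = y * (abel_poly y N 0 ^+ a.+1 * abel_poly y N (u + y))`_m.
  rewrite -mulrA coefCM -mulrA coefXM /=; congr (_ * _).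
  rewrite mulrCA exprSr -mulrA !(mulrC (_ ^+ a)).
  apply: coefM_trunc => j jm.
  have := @coef_abel_poly_prod R y N 1 (fun=> y) u j (leq_trans jm (ltnW mN)).
  by rewrite !big_ord1 expr1 mulrC.
rewrite IHm ?(ltnW mN) // [in RHS]big_ord_recl [X in X + _]big_ord_recl.
rewrite !bin0 -addrA; congr (_ + _).
rewrite mulr_sumr -big_split; apply: eq_bigr => j _ /=.
rewrite /bump leq0n add1n subSS.
have -> : u + y + m%:R * y = u + m.+1%:R * y by rewrite -natr1; ring.
by rewrite !addnS /= binS natrD exprS; ring.
Qed.

Definition Gpoly (R : realType) (a n : nat) : {poly R} :=
  \poly_(j < n.+1) ('C((a + j).-1, j)%:R * (n ^_ j)%:R / n%:R ^+ j).

Lemma G_horner {R : realType} a n (l : R) : (0 < n)%N ->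
  G a.+1 n l = (Gpoly R a n).[l].
Proof.
move=> n0.
pose p : 'rV[R]_a.+1 := \row_i (i == ord0)%:R.
have ps : simplex R a.+1 p.
  split=> [i|]; first by rewrite mxE ler0n.
  rewrite big_ord_recl mxE eqxx big1 ?addr0 // => i _.
  by rewrite mxE.
have n0' : n%:R != 0 :> R by rewrite pnatr_eq0 -lt0n.
rewrite -(G_simplex _ _ ps) Gp_coef big_ord_recl coef_abel_poly_prod //.
rewrite -mulr_sumr -mulrDr; case: (ps) => _; rewrite big_ord_recl => ->.
rewrite mulr1 coef_abel_pow // horner_poly mulr_sumr; apply: eq_bigr => j _.
(* the powers (u + n y)^(n - j) disappear because u + n y = 1 here *)
have -> : 1 - l + n%:R * (l / n%:R) = 1 by field.
rewrite expr1n -(ffact_fact (leq_ord j)) natrM expr_div_n.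
have f0 : (n - j)`!%:R != 0 :> R by rewrite pnatr_eq0 -lt0n fact_gt0.
by field; rewrite f0 expf_neq0.
Qed.

(** * The differential equation *)

Lemma coef_Gpoly {R : realType} a n j :
  (Gpoly R a n)`_j = 'C((a + j).-1, j)%:R * (n ^_ j)%:R / n%:R ^+ j.
Proof.
rewrite coef_poly ltnS; case: leqP => // nj.
by rewrite ffact_small // mulr0 mul0r.
Qed.

Lemma coef_Gpoly_ge0 {R : realType} a n j : 0 <= (Gpoly R a n)`_j.
Proof. by rewrite coef_Gpoly divr_ge0 ?exprn_ge0 // mulr_ge0. Qed.

Lemma coef_GpolyS {R : realType} a n j : (0 < n)%N ->
  j.+1%:R * (Gpoly R a n)`_j.+1 =
  (a + j)%:R * (1 - j%:R / n%:R) * (Gpoly R a n)`_j.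
Proof.
move=> n0; rewrite !coef_Gpoly addnS /=.
have n0' : n%:R != 0 :> R by rewrite pnatr_eq0 -lt0n.
have -> : (n ^_ j.+1)%:R = (n ^_ j)%:R * (n%:R - j%:R) :> R.
  rewrite ffactnSr natrM; case: (leqP j n) => [jn|nj]; first by rewrite natrB.
  by rewrite ffact_small // !mul0r.
have := mul_bin_diag (a + j) j => /(congr1 (fun x : nat => x%:R : R)).
rewrite !natrM => E.
rewrite !mulrA -E exprS; field.
by rewrite n0' expf_neq0.
Qed.

(** For [m = 0] this is the recursion [coef_GpolyS] on coefficients; each
    further equation is the derivative of the preceding one. *)
Lemma Gpoly_derivn_ode {R : realType} a n m : (0 < n)%N ->
  let Q := (Gpoly R a n)^`(m) in
  Q^`() = (a + m)%:R * Q + 'X * Q^`()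
    - (n%:R^-1)%:P * ((m * (a + m))%:R * Q + (a + 2 * m).+1%:R * ('X * Q^`())
                       + 'X * ('X * Q^`()^`())).
Proof.
move=> n0; elim: m => [|m IHm] Q.
  rewrite {}/Q derivn0 mul0n !addn0 mul0r add0r; set P := Gpoly R a n.
  apply/polyP => j; rewrite coefB !coefD coefCM !mulr_natl !coefD !coefMn.
  have E i : P`_i.+1 *+ i.+1 = (a + i)%:R * (1 - i%:R / n%:R) * P`_i.
    by rewrite -coef_GpolyS // mulr_natl.
  rewrite !coefXM !coef_deriv; case: j => [|j] /=.
    by rewrite E; ring.
  rewrite E; case: j => [|j] /=.
    by rewrite -mulr_natl; ring.
  ring.
move: IHm; rewrite /Q derivnS; set S := (Gpoly R a n)^`(m) => /(congr1 deriv) E.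
rewrite [LHS]E !(derivB, derivD, deriv_mulC) !mulr_natl !(derivMn, derivM, derivX, derivD).
ring.
Qed.

Lemma horner_derivn_Gpoly_ge0 {R : realType} a n m (l : R) : 0 <= l ->
  0 <= (Gpoly R a n)^`(m).[l].
Proof.
move=> l0; rewrite horner_coef sumr_ge0 // => i _.
by rewrite coef_derivn mulr_ge0 ?exprn_ge0 ?mulrn_wge0 ?coef_Gpoly_ge0.
Qed.

Lemma horner_Gpoly_ode {R : realType} a n m (l : R) : (0 < n)%N ->
  let d j := (Gpoly R a n)^`(j).[l] in
  (1 - l) * d m.+1 = (a + m)%:R * d m
    - (m%:R * (a + m)%:R * d m + (a + 2 * m).+1%:R * l * d m.+1
       + l ^+ 2 * d m.+2) / n%:R.
Proof.
move=> n0 d; have := @Gpoly_derivn_ode R a n m n0 => /(congr1 (horner^~ l)).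
rewrite -!derivnS !mulr_natl !(hornerD, hornerN, hornerM, hornerMn, hornerX, hornerC).
rewrite -/(d m) -/(d m.+1) -/(d m.+2) => E.
by rewrite mulrBl mul1r {1}E; ring.
Qed.

(** The terms in [1 / n] of the differential equation have the favourable
    sign; what is left says that [(1 - l)^(a + m) P^(m)] is nonincreasing
    between 0 and 1. *)
Lemma horner_derivn_Gpoly_le {R : realType} a n m (l : R) : (0 < n)%N -> 0 <= l ->
  (1 - l) * (Gpoly R a n)^`(m.+1).[l] <= (a + m)%:R * (Gpoly R a n)^`(m).[l].
Proof.
move=> n0 l0; rewrite horner_Gpoly_ode // gerBl divr_ge0 // !addr_ge0 //;
  by rewrite !mulr_ge0 ?horner_derivn_Gpoly_ge0 ?exprn_ge0.
Qed.

Lemma Gpoly_ge1 {R : realType} a n (l : R) : 0 <= l -> 1 <= (Gpoly R a n).[l].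
Proof.
move=> l0; rewrite horner_poly big_ord_recl !expr0 mulr1 bin0 ffactn0 divr1.
rewrite mulr1 lerDl sumr_ge0 // => j _.
by rewrite mulr_ge0 ?exprn_ge0 // divr_ge0 ?exprn_ge0 // mulr_ge0.
Qed.

(** * Minimizers are interior *)

Lemma bernoulli_le {R : realType} (x : R) j : -1 <= x -> 1 + j%:R * x <= (1 + x) ^+ j.
Proof.
move=> x1; elim: j => [|j IH]; first by rewrite mul0r addr0 expr0.
have h : 0 <= 1 + x by lra.
rewrite exprS; apply: (le_trans _ (ler_wpM2l h IH)).
have : 0 <= j%:R * x ^+ 2 :> R by rewrite mulr_ge0 ?sqr_ge0.
rewrite -natr1; nra.
Qed.

Lemma ffact_expn_le {R : realType} n m j : (0 < n)%N -> (j <= m)%N -> (m <= n)%N ->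
  (1 - m%:R / n%:R) ^+ j <= (n ^_ j)%:R / n%:R ^+ j :> R.
Proof.
move=> n0 jm mn; elim: j jm => [|j IH] jm; first by rewrite ffactn0 !expr0 divr1.
have n0' : 0 < n%:R :> R by rewrite ltr0n.
have jn : (j <= n)%N by apply: leq_trans mn; exact: ltnW.
rewrite exprSr ffactnSr natrM natrB // exprSr invfM mulrACA.
have -> : (n%:R - j%:R) / n%:R = 1 - j%:R / n%:R :> R by field; rewrite gt_eqF.
apply: ler_pM; rewrite ?IH ?(ltnW jm) ?exprn_ge0 //.
- by rewrite subr_ge0 ler_pdivrMr // mul1r ler_nat.
- by rewrite subr_ge0 ler_pdivrMr // mul1r ler_nat.
- by rewrite lerB // ler_pM2r ?invr_gt0 // ler_nat ltnW.
Qed.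

(** For fixed [m] the lower bound tends to [m + 1] as [l] tends to 1 and [n] to
    infinity: this is how [P_n] gets large near 1. Each of the first [m + 1]
    terms is at least [(l (1 - m / n))^j], to which Bernoulli's inequality
    applies. *)
Lemma Gpoly_ge {R : realType} a n m (l : R) : (0 < a)%N -> (0 < n)%N -> (m <= n)%N ->
  0 <= l <= 1 ->
  m.+1%:R * (1 - m%:R * (1 - l) - m%:R ^+ 2 / n%:R) <= (Gpoly R a n).[l].
Proof.
move=> a0 n0 mn /andP[l0 l1].
have n0' : 0 < n%:R :> R by rewrite ltr0n.
have u0 : 0 <= 1 - m%:R / n%:R :> R.
  by rewrite subr_ge0 ler_pdivrMr // mul1r ler_nat.
rewrite horner_poly -(big_mkord xpredT
  (fun j => 'C((a + j).-1, j)%:R * (n ^_ j)%:R / n%:R ^+ j * l ^+ j)).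
rewrite (big_cat_nat (n := m.+1)) //=; apply: (@le_trans _ _ (_ + 0)); last first.
  apply: lerD; last first.
    by apply: sumr_ge0 => j _; rewrite mulr_ge0 ?exprn_ge0 // divr_ge0 ?exprn_ge0 // mulr_ge0.
  apply: (ler_sum_nat (F := fun=> 1 - m%:R * (1 - l) - m%:R ^+ 2 / n%:R)).
  move=> j /andP[_]; rewrite ltnS => jm.
  have b1 : 1 <= 'C((a + j).-1, j)%:R :> R.
    by rewrite ler1n bin_gt0 -ltnS prednK ?addn_gt0 ?a0 // -add1n leq_add2r.
  apply: (@le_trans _ _ (1 * ((1 - m%:R / n%:R) ^+ j * l ^+ j))); last first.
    rewrite -!mulrA; apply: ler_pM => //; first by rewrite mulr_ge0 ?exprn_ge0.
    by rewrite mulrA ler_wpM2r ?exprn_ge0 // ffact_expn_le.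
  rewrite mul1r -exprMn.
  have x1 : -1 <= (1 - m%:R / n%:R) * l - 1 by rewrite lerBrDl subrr mulr_ge0.
  have := bernoulli_le _ j x1; rewrite [1 + (_ - 1)]addrC subrK; apply: le_trans.
  have m0 : 0 <= m%:R :> R by [].
  have jm' : j%:R <= m%:R :> R by rewrite ler_nat.
  have q0 : 0 <= m%:R / n%:R :> R by rewrite divr_ge0.
  have -> : m%:R ^+ 2 / n%:R = m%:R * (m%:R / n%:R) :> R by rewrite expr2 mulrA.
  move: (m%:R / n%:R) q0 u0 x1 => q q0 u0 _.
  have s0 : 0 <= 1 - (1 - q) * l by nra.
  have h1 : 0 <= (m%:R - j%:R) * (1 - (1 - q) * l) by rewrite mulr_ge0 // subr_ge0.
  have h2 : 0 <= m%:R * (q * (1 - l)) by rewrite !mulr_ge0 ?subr_ge0.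
  lra.
by rewrite addr0 sumr_const_nat subn0 mulr_natl.
Qed.

Definition tilt {R : realType} (t : R) (p : {poly R}) (l : R) : R :=
  expR (- (l * t)) * p.[l].

Lemma is_derive_tilt {R : realType} (t : R) (p : {poly R}) (x : R) :
  is_derive x (1 : R) (tilt t p) (expR (- (x * t)) * (p^`().[x] - t * p.[x])).
Proof.
have de : is_derive x (1 : R) (fun l => expR (- (l * t))) (- t * expR (- (x * t))).
  have -> : (fun l => expR (- (l * t))) = expR \o (- t \*: id).
    by apply/funext => l /=; rewrite /GRing.scale /= mulNr mulrC.
  have dm := is_deriveZ (- t) (is_derive_id x (1 : R)).
  have := is_derive1_comp (is_derive_expR _) dm.
  by rewrite /= /GRing.scale /= mulr1 mulNr (mulrC t x) [_ * - t]mulrC.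
have := is_deriveM de (is_derive_poly p x).
rewrite /tilt => d; apply: is_derive_eq.
rewrite /GRing.scale /=; ring.
Qed.

(** The objective decreases between 0 and [1 - a / t]: there [(1 - x) t > a], so
    [(1 - x) P' <= a P] forces [P' < t P]. The value at the right end beats the
    one at 0. *)
Lemma tilt_minimizer_gt0 {R : realType} a n (t l : R) : (0 < a)%N -> (0 < n)%N ->
  a%:R < t -> is_minimizer `[0, 1] (tilt t (Gpoly R a n)) l -> 0 < l.
Proof.
move=> a0 n0 at_ [l01 lmin]; have t0 : 0 < t by rewrite (le_lt_trans _ at_).
have /andP[l0 l1] : 0 <= l <= 1 by move: l01; rewrite /= in_itv.
rewrite lt_neqAle l0 andbT; apply/eqP => l_eq0; move: lmin; rewrite -l_eq0.
pose c := 1 - a%:R / t.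
have c0 : 0 < c by rewrite subr_gt0 ltr_pdivrMr // mul1r.
have c1 : c <= 1 by rewrite gerBl divr_ge0 // ltW.
set f := tilt t _ => /(_ c); rewrite /= in_itv /= (ltW c0) c1 => /(_ isT).
have [|xi] := @MVT R f _ 0 c c0 (fun x _ => is_derive_tilt t (Gpoly R a n) x).
  by apply: derivable_within_continuous => x _; case: (is_derive_tilt t (Gpoly R a n) x).
rewrite in_itv /= => /andP[xi0 xic] E.
apply/negP; rewrite -ltNge -subr_lt0 E subr0 pmulr_llt0 // pmulr_rlt0 ?expR_gt0 //.
have := @horner_derivn_Gpoly_le R a n 0 xi n0 (ltW xi0).
have P1 := @Gpoly_ge1 R a n xi (ltW xi0).
rewrite derivn0 derivn1 addn0; move: P1; set p := _.[_]; set p' := _.[_] => P1.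
have : a%:R < (1 - xi) * t by rewrite -ltr_pdivrMr // ltrBrDl -ltrBrDr.
nra.
Qed.

Lemma tilt_minimizer_critical {R : realType} (p : {poly R}) (t l : R) :
  0 < l < 1 -> is_minimizer `[0, 1] (tilt t p) l -> p^`().[l] = t * p.[l].
Proof.
move=> l01 [_ lmin].
have [|||_ d0] := @derive1_at_min R (tilt t p) 0 1 l ler01.
- by move=> x _; case: (is_derive_tilt t p x).
- by rewrite in_itv.
- move=> x; rewrite in_itv /= => /andP[x0 x1].
  by apply: lmin; rewrite /= in_itv /= !ltW.
have [_] := is_derive_tilt t p l; rewrite d0 => /esym/eqP.
by rewrite mulf_eq0 gt_eqF ?expR_gt0 //= subr_eq0 => /eqP.
Qed.

(** The value 1 at 0 gives [P_n(l) <= e^t] at a minimizer [l]. In [Gpoly_ge] with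
    [m + 1 >= 4 e^t] this bounds [1 - m (1 - l) - m^2 / n] by [1 / 4], and
    [m^2 / n <= 1 / 4] then leaves [m (1 - l) >= 1 / 2]. *)
Lemma tilt_minimizer_away1 {R : realType} a (t : R) : (0 < a)%N -> 0 <= t ->
  exists2 d : R, 0 < d & \forall n \near \oo,
    forall l, is_minimizer `[0, 1] (tilt t (Gpoly R a n)) l -> l <= 1 - d.
Proof.
move=> a0 t0; pose m := (Num.trunc (4 * expR t)).+1.
have hm : 4 * expR t <= m.+1%:R by rewrite ltW // (lt_trans (truncnS_gt _)) ?ltr_nat.
have m0 : 0 < m%:R :> R by rewrite ltr0n.
exists (2 * m%:R)^-1; first by rewrite invr_gt0 mulr_gt0.
near=> n => l [l01 lmin].
have mn : (4 * m ^ 2 <= n)%N by near: n; exact: nbhs_infty_ge.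
have n0 : (0 < n)%N by apply: leq_trans mn; rewrite muln_gt0 expn_gt0.
have mn' : (m <= n)%N by apply: leq_trans mn; rewrite expnS expn1 mulnA leq_pmull.
have /andP[l0 l1] : 0 <= l <= 1 by move: l01; rewrite /= in_itv.
have := @Gpoly_ge R a n m l a0 n0 mn'; rewrite l0 l1 => /(_ isT).
have le1 : (Gpoly R a n).[l] <= expR t.
  have /lmin : [set` `[0, 1]] (0 : R) by rewrite /= in_itv /= lexx ler01.
  rewrite /tilt mul0r oppr0 expR0 mul1r expRN mulrC ler_pdivrMr ?expR_gt0 //.
  have -> : (Gpoly R a n).[0] = 1.
    by rewrite horner_coef0 coef_Gpoly bin0 ffactn0 expr0 divr1 mulr1.
  rewrite mul1r => /le_trans; apply; rewrite ler_expR; nra.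
have qle : m%:R ^+ 2 / n%:R <= 4^-1 :> R.
  rewrite ler_pdivrMr ?ltr0n // ler_pdivlMl // -natrX -natrM ler_nat //.
rewrite lerBrDr -lerBrDl => ge1.
have h : 1 - m%:R * (1 - l) - m%:R ^+ 2 / n%:R <= 4^-1.
  have e0 := expR_gt0 t.
  rewrite leNgt; apply/negP => h.
  have : m.+1%:R * 4^-1 < m.+1%:R * (1 - m%:R * (1 - l) - m%:R ^+ 2 / n%:R).
    by rewrite ltr_pM2l.
  lra.
rewrite invfM ler_pdivrMr //; lra.
Unshelve. all: by end_near. Qed.

(** * The expansion of the critical points *)

(** The differential equations for [P] and [P'], divided by [P] at a point where
    [P' = t P]. The two bounds make [q], then [w], bounded as long as [l] stays
    away from 1. *)
Lemma Gpoly_critical {R : realType} a n (t l : R) : (0 < n)%N -> 0 <= l < 1 ->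
  let P := Gpoly R a n in
  let q := P^`(2).[l] / P.[l] in let w := P^`(3).[l] / P.[l] in
  P^`().[l] = t * P.[l] ->
  [/\ (1 - l) * t = a%:R - (a.+1%:R * l * t + l ^+ 2 * q) / n%:R,
      (1 - l) * q = a.+1%:R * t
        - (a.+1%:R * t + a.+3%:R * l * q + l ^+ 2 * w) / n%:R,
      0 <= q /\ (1 - l) * q <= a.+1%:R * t
    & 0 <= w /\ (1 - l) * w <= a.+2%:R * q].
Proof.
move=> n0 /andP[l0 l1] P q w; rewrite -derivn1 => crit.
have P0 : 0 < P.[l] by rewrite (lt_le_trans ltr01) ?Gpoly_ge1.
have Pn0 : P.[l] != 0 by rewrite gt_eqF.
have n0' : n%:R != 0 :> R by rewrite pnatr_eq0 -lt0n.
have qE : P^`(2).[l] = q * P.[l] by rewrite divfK.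
have wE : P^`(3).[l] = w * P.[l] by rewrite divfK.
have e0 := @horner_Gpoly_ode R a n 0 l n0.
have e1 := @horner_Gpoly_ode R a n 1 l n0.
have i1 := @horner_derivn_Gpoly_le R a n 1 l n0 l0.
have i2 := @horner_derivn_Gpoly_le R a n 2 l n0 l0.
rewrite /= -/P !(derivn0, crit, qE, wE) in e0 e1 i1 i2.
rewrite ?muln1 ?muln0 ?addn0 ?addn1 ?addn2 in e0 e1 i1 i2.
split.
- by apply: (mulIf Pn0); rewrite -[LHS]mulrA ?qE e0; field.
- by apply: (mulIf Pn0); rewrite -[LHS]mulrA ?qE e1; field.
- split; first by rewrite divr_ge0 ?horner_derivn_Gpoly_ge0 // ltW.
  by rewrite -(ler_pM2r P0) -[leLHS]mulrA -[leRHS]mulrA.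
- split; first by rewrite divr_ge0 ?horner_derivn_Gpoly_ge0 // ltW.
  by rewrite -(ler_pM2r P0) -[leLHS]mulrA -[leRHS]mulrA.
Qed.

Lemma cvg_bounded_divn {R : realType} (u : nat -> R) C :
  (\forall n \near \oo, 0 <= u n <= C) -> u n / n%:R @[n --> \oo] --> (0 : R).
Proof.
move=> uC.
have v0 : (n%:R^-1 : R) @[n --> \oo] --> 0.
  have : (\forall n \near \oo, 0 < (n%:R : R)).
    by near=> n; rewrite ltr0n; near: n; exact: nbhs_infty_gt.
  by move/gtr0_cvgV0 => [_]; apply; exact: cvgr_idn.
apply: (@squeeze_cvgr _ _ _ _ (fun=> 0) (fun n => C * n%:R^-1)).
- near=> n; have /andP[u0 uc] : 0 <= u n <= C by near: n.
  by rewrite divr_ge0 //= ler_wpM2r.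
- exact: cvg_cst.
- by rewrite -(mulr0 C); apply: cvgM => //; exact: cvg_cst.
Unshelve. all: by end_near. Qed.

(** The first equation is [l = 1 - a / t + X / n] with [X] bounded, which yields
    the limit of [l]; the second one then yields the limit of [q]. These two
    limits give that of [X], which is the quantity to be computed. *)
Lemma cvg_critical {R : realType} (a : nat) (t d B : R) (l q w : nat -> R) :
  (0 < a)%N -> 0 < t -> 0 < d ->
  (\forall n \near \oo,
     (1 - l n) * t = a%:R - (a.+1%:R * l n * t + l n ^+ 2 * q n) / n%:R) ->
  (\forall n \near \oo,
     (1 - l n) * q n = a.+1%:R * t
        - (a.+1%:R * t + a.+3%:R * l n * q n + l n ^+ 2 * w n) / n%:R) ->
  (\forall n \near \oo, [/\ 0 <= l n <= 1 - d, 0 <= q n <= B & 0 <= w n <= B]) ->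
  n%:R * (l n - (1 - a%:R / t)) @[n --> \oo] --> a.+1%:R * (t - a%:R) / a%:R.
Proof.
move=> a0 t0 d0 el eq bd.
have a0' : a%:R != 0 :> R by rewrite pnatr_eq0 -lt0n.
have tn0 : t != 0 by rewrite gt_eqF.
pose X n := a.+1%:R * l n + l n ^+ 2 * q n / t.
pose Y n := a.+1%:R * t + a.+3%:R * l n * q n + l n ^+ 2 * w n.
have elX : \forall n \near \oo, l n = 1 - a%:R / t + X n / n%:R.
  near=> n; have n0 : n%:R != 0 :> R.
    by rewrite pnatr_eq0 -lt0n; near: n; exact: nbhs_infty_gt.
  have E : (1 - l n) * t = a%:R - (a.+1%:R * l n * t + l n ^+ 2 * q n) / n%:R by near: n.
  rewrite [LHS](_ : _ = 1 - (1 - l n) * t / t); last by field.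
  by rewrite E /X; field; rewrite tn0 n0.
have hl : l n @[n --> \oo] --> 1 - a%:R / t.
  have hX : X n / n%:R @[n --> \oo] --> 0.
    apply: (@cvg_bounded_divn _ _ (a.+1%:R + B / t)); near=> n.
    have [/andP[l0 l1] /andP[q0 qB] _] :
      [/\ 0 <= l n <= 1 - d, 0 <= q n <= B & 0 <= w n <= B] by near: n.
    have l1' : l n <= 1 by lra.
    have l2 : l n ^+ 2 <= 1 by rewrite exprn_ile1.
    rewrite addr_ge0 ?mulr_ge0 ?exprn_ge0 ?invr_ge0 ?(ltW t0) //=.
    apply: lerD; first by rewrite -[leRHS]mulr1 ler_wpM2l.
    rewrite ler_pM2r ?invr_gt0 //; apply: le_trans qB.
    by rewrite -[leRHS]mul1r ler_wpM2r.
  have : 1 - a%:R / t + X n / n%:R @[n --> \oo] --> 1 - a%:R / t + 0.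
    by apply: cvgD hX; exact: cvg_cst.
  rewrite addr0; apply: cvg_trans; apply: near_eq_cvg.
  near=> n; apply/esym; near: n; exact: elX.
have hq : q n @[n --> \oo] --> a.+1%:R * t / (a%:R / t).
  have hY : Y n / n%:R @[n --> \oo] --> 0.
    apply: (@cvg_bounded_divn _ _ (a.+1%:R * t + a.+3%:R * B + B)); near=> n.
    have [/andP[l0 l1] /andP[q0 qB] /andP[w0 wB]] :
      [/\ 0 <= l n <= 1 - d, 0 <= q n <= B & 0 <= w n <= B] by near: n.
    have l1' : l n <= 1 by lra.
    have l2 : l n ^+ 2 <= 1 by rewrite exprn_ile1.
    rewrite !addr_ge0 ?mulr_ge0 ?exprn_ge0 ?(ltW t0) //=.
    apply: lerD; first apply: lerD => //.
      rewrite -mulrA ler_wpM2l //; apply: le_trans qB.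
      by rewrite -[leRHS]mul1r ler_wpM2r.
    apply: le_trans wB.
    by rewrite -[leRHS]mul1r ler_wpM2r.
  have : (a.+1%:R * t - Y n / n%:R) / (1 - l n) @[n --> \oo] -->
      (a.+1%:R * t - 0) / (1 - (1 - a%:R / t)).
    apply: cvgM; first by apply: cvgB hY; exact: cvg_cst.
    apply: cvgV; last by apply: cvgB hl; exact: cvg_cst.
    by rewrite subKr mulf_neq0 ?invr_eq0.
  rewrite subr0 subKr; apply: cvg_trans; apply: near_eq_cvg; near=> n.
  have <- : (1 - l n) * q n = a.+1%:R * t - Y n / n%:R by near: n.
  have [/andP[l0 l1] _ _] :
      [/\ 0 <= l n <= 1 - d, 0 <= q n <= B & 0 <= w n <= B] by near: n.
  by rewrite mulrAC divff ?mul1r // gt_eqF //; lra.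
have : X n @[n --> \oo] -->
    a.+1%:R * (1 - a%:R / t) + (1 - a%:R / t) ^+ 2 * (a.+1%:R * t / (a%:R / t)) / t.
  apply: cvgD; first by apply: cvgM hl; exact: cvg_cst.
  apply: cvgM; last exact: cvg_cst.
  by apply: cvgM hq; rewrite expr2; exact: cvgM.
have -> : a.+1%:R * (1 - a%:R / t) + (1 - a%:R / t) ^+ 2 * (a.+1%:R * t / (a%:R / t)) / t
    = a.+1%:R * (t - a%:R) / a%:R by field; rewrite a0' tn0.
apply: cvg_trans; apply: near_eq_cvg; near=> n.
have n0 : n%:R != 0 :> R by rewrite pnatr_eq0 -lt0n; near: n; exact: nbhs_infty_gt.
have {1}-> : l n = 1 - a%:R / t + X n / n%:R by near: n.
by field; rewrite tn0 n0.
Unshelve. all: by end_near. Qed.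

Theorem proposition7 (R : realType) (k : nat) (t : R) (lam : nat -> R)
    (hk : (2 <= k)%N) (ht : k%:R - 1 < t)
    (hlam : forall n : nat, (1 <= n)%N ->
       is_minimizer `[0, 1] (fun l : R => expR (- (l * t)) * G k n l) (lam n)) :
  let lam_inf : R := 1 - (k%:R - 1) / t in
  (fun n : nat => lam n -
     (lam_inf + k%:R / (k%:R - 1) * ((t - k%:R + 1) / n%:R)))
    =o_\oo (fun n : nat => n%:R^-1 : R).
Proof.
move=> lam_inf; rewrite {}/lam_inf.
case: k hk ht hlam => [|a] // a0 at_ hlam; rewrite ltnS in a0.
have aE : a.+1%:R - 1 = a%:R :> R by rewrite -natr1 addrK.
rewrite aE in at_ *.
have t0 : 0 < t by rewrite (le_lt_trans _ at_).
have a0' : a%:R != 0 :> R by rewrite pnatr_eq0 -lt0n.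
have lmin n : (0 < n)%N -> is_minimizer `[0, 1] (tilt t (Gpoly R a n)) (lam n).
  move=> n0; have := hlam n n0; congr (is_minimizer _ _ _).
  by apply/funext => l; rewrite /tilt G_horner.
have [d d0 led] := @tilt_minimizer_away1 R a t a0 (ltW t0).
have l01 : \forall n \near \oo, [/\ (0 < n)%N, 0 < lam n & lam n <= 1 - d].
  near=> n; have n0 : (0 < n)%N by near: n; exact: nbhs_infty_gt.
  split=> //; first exact: (tilt_minimizer_gt0 _ _ _ _ a0 n0 at_ (lmin n n0)).
  by apply: (near led n _ (lam n) (lmin n n0)).
have main : \forall n \near \oo, [/\ (0 < n)%N, 0 < lam n, lam n <= 1 - d
    & (Gpoly R a n)^`().[lam n] = t * (Gpoly R a n).[lam n]].
  apply: filterS l01 => n [n0 l0 l1]; split=> //.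
  by apply: (tilt_minimizer_critical _ _ _ _ (lmin n n0)); rewrite l0; lra.
pose B := a.+1%:R * t / d.
pose q n := (Gpoly R a n)^`(2).[lam n] / (Gpoly R a n).[lam n].
pose w n := (Gpoly R a n)^`(3).[lam n] / (Gpoly R a n).[lam n].
have crit : \forall n \near \oo, [/\
    (1 - lam n) * t = a%:R - (a.+1%:R * lam n * t + lam n ^+ 2 * q n) / n%:R,
    (1 - lam n) * q n = a.+1%:R * t
        - (a.+1%:R * t + a.+3%:R * lam n * q n + lam n ^+ 2 * w n) / n%:R,
    0 <= lam n <= 1 - d, 0 <= q n <= B & 0 <= w n <= a.+2%:R * B / d].
  apply: filterS main => n [n0 l0 l1 e].
  have l01' : 0 <= lam n < 1 by rewrite ltW //=; lra.
  have [e1 e2 [q0 qB] [w0 wB]] := Gpoly_critical _ _ _ _ n0 l01' e.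
  have dl : d <= 1 - lam n by lra.
  have qB' : q n <= B.
    by rewrite ler_pdivlMr // (le_trans _ qB) // mulrC ler_wpM2r.
  split=> //; first by rewrite (ltW l0).
    by rewrite q0.
  rewrite w0 /= ler_pdivlMr // mulrC.
  apply: (le_trans (ler_wpM2r w0 dl)); apply: (le_trans wB).
  by rewrite ler_wpM2l.
pose C := B + a.+2%:R * B / d.
have B0 : 0 <= B by apply: divr_ge0; rewrite ?mulr_ge0 ?ltW.
have B0' : 0 <= a.+2%:R * B / d by apply: divr_ge0; [exact: mulr_ge0 | exact: ltW].
have lim : n%:R * (lam n - (1 - a%:R / t)) @[n --> \oo] --> a.+1%:R * (t - a%:R) / a%:R.
  apply: (@cvg_critical _ _ _ d C lam q w a0 t0 d0); apply: filterS crit => n [] //.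
  move=> _ _ -> /andP[-> qB] /andP[-> wB]; split=> //=; rewrite /C; lra.
apply/eqoP => e e0.
move/cvgrPdist_le : lim => /(_ _ e0); apply: filterS2 (nbhs_infty_gt 0) => n n0.
have n0' : n%:R != 0 :> R by rewrite pnatr_eq0 -lt0n.
rewrite distrC => le_e; have -> : lam n - (1 - a%:R / t + a.+1%:R / a%:R * ((t - a.+1%:R + 1) / n%:R))
  = (n%:R * (lam n - (1 - a%:R / t)) - a.+1%:R * (t - a%:R) / a%:R) * n%:R^-1.
  by field; rewrite n0' a0' gt_eqF.
by rewrite normrM ler_wpM2r.
Unshelve. all: by end_near. Qed.
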